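(* Let $L$ be a first-order language, $\{\mathcal{A}_\lambda : \lambda\in\Lambda\}$ a family of $L$-structures, and $\mathcal{A}=\prod_{\lambda\in\Lambda}\mathcal{A}_\lambda$ the direct product. Then every definable subset of $\mathcal{A}^n$ is a finite Boolean combination of open sets in the discrete-product topology on $\mathcal{A}^n$.
   Context: ''Definable'' means definable by a first-order $L$-formula with parameters from $\mathcal{A}$. The direct product $\prod_\lambda\mathcal{A}_\lambda$ has universe the Cartesian product; constants and functions are interpreted coordinatewise, and a relation symbol $R$ holds of $\bar{a}$ iff it holds of $\bar{a}[\lambda]=(a_1(\lambda),\dots,a_k(\lambda))$ in $\mathcal{A}_\lambda$ for every $\lambda\in\Lambda$. The discrete-product topology on $(\prod_\lambda\mathcal{A}_\lambda)^n$ is obtained by giving each $\mathcal{A}_\lambda$ the discrete topology, taking the (Tychonoff) product topology on $\prod_\lambda\mathcal{A}_\lambda$, and then the product topology on its $n$-th power; a basis consists of the sets $\{\bar{x}\in\mathcal{A}^n : \bar{x}[\lambda]=\bar{b}[\lambda]\text{ for all }\lambda\in\Lambda_0\}$, with $\Lambda_0\subseteq\Lambda$ finite and $\bar{b}\in(\prod_{\lambda\in\Lambda_0}\mathcal{A}_\lambda)^n$. *)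

(* Defs.v *)
From HB Require Import structures.
From mathcomp Require Import all_boot all_classical.
From mathcomp Require Import topology.

Set Implicit Arguments.
Unset Strict Implicit.
Unset Printing Implicit Defensive.

Local Open Scope classical_set_scope.

(* Constant symbols are the function symbols of arity 0. *)
Record language := Language {
  func_symbol : Type;
  func_arity : func_symbol -> nat;
  rel_symbol : Type;
  rel_arity : rel_symbol -> nat
}.

(* Carriers may be empty; the usual convention is the special case in which
   they are inhabited. *)
Record structure (L : language) := Structure {
  carrier :> Type;
  func_interp (f : func_symbol L) : ('I_(func_arity f) -> carrier) -> carrier;
  rel_interp (r : rel_symbol L) : ('I_(rel_arity r) -> carrier) -> Prop
}.

Arguments func_interp {L} _ f _.
Arguments rel_interp {L} _ r _.

Definition direct_product (L : language) (I : Type) (A : I -> structure L) :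
    structure L := {|
  carrier := forall l, A l;
  func_interp f a := fun l => func_interp (A l) f (fun i => a i l);
  rel_interp r a := forall l, rel_interp (A l) r (fun i => a i l)
|}.

Inductive term (L : language) (n : nat) : Type :=
| Var : 'I_n -> term L n
| App (f : func_symbol L) : ('I_(func_arity f) -> term L n) -> term L n.

(* [formula L n] is the type of first-order formulas whose free variables are
   among x_0, ..., x_(n-1); in [All phi] and [Ex phi] the variable x_n of
   [phi : formula L n.+1] is the bound one. *)
Inductive formula (L : language) : nat -> Type :=
| Equal n : term L n -> term L n -> formula L n
| Rel n (r : rel_symbol L) : ('I_(rel_arity r) -> term L n) -> formula L n
| Bot n : formula L n
| Not n : formula L n -> formula L n
| And n : formula L n -> formula L n -> formula L n
| Or n : formula L n -> formula L n -> formula L n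
| Imp n : formula L n -> formula L n -> formula L n
| All n : formula L n.+1 -> formula L n
| Ex n : formula L n.+1 -> formula L n.

Section semantics.
Context {L : language} (A : structure L).

Fixpoint eval n (x : 'I_n -> A) (t : term L n) : A :=
  match t with
  | Var i => x i
  | App f ts => func_interp A f (fun i => eval x (ts i))
  end.

Definition extend n (x : 'I_n -> A) (a : A) : 'I_n.+1 -> A :=
  fun i => if unlift ord_max i is Some j then x j else a.

Definition concat n m (x : 'I_n -> A) (b : 'I_m -> A) : 'I_(n + m) -> A :=
  fun i => match fintype.split i with inl j => x j | inr k => b k end.

Fixpoint sat n (phi : formula L n) : ('I_n -> A) -> Prop :=
  match phi in formula _ n return ('I_n -> A) -> Prop with
  | Equal _ s t => fun x => eval x s = eval x t
  | Rel _ r ts => fun x => rel_interp A r (fun i => eval x (ts i))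
  | Bot _ => fun=> False
  | Not _ p => fun x => ~ sat p x
  | And _ p q => fun x => sat p x /\ sat q x
  | Or _ p q => fun x => sat p x \/ sat q x
  | Imp _ p q => fun x => sat p x -> sat q x
  | All _ p => fun x => forall a, sat p (extend x a)
  | Ex _ p => fun x => exists a, sat p (extend x a)
  end.

Definition definable n (X : set ('I_n -> A)) : Prop :=
  exists (m : nat) (phi : formula L (n + m)) (b : 'I_m -> A),
    X = [set x | sat phi (concat x b)].

End semantics.

(* [{classic _}] only provides the choice structure that the library requires
   of the points of a topological space; the carrier is unchanged, so the
   points of [discrete_product_power A n] are those of
   ['I_n -> direct_product A]. *)
Definition discrete_product_power (L : language) (I : Type)
    (A : I -> structure L) (n : nat) : topologicalType :=
  prod_topology (fun _ : 'I_n =>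
    prod_topology (fun l : I => discrete_topology {classic A l})).

Inductive boolean_combination (T : Type) (G : set (set T)) : set T -> Prop :=
| bc_base U : G U -> boolean_combination G U
| bc_compl X : boolean_combination G X -> boolean_combination G (~` X)
| bc_union X Y : boolean_combination G X -> boolean_combination G Y ->
    boolean_combination G (X `|` Y)
| bc_inter X Y : boolean_combination G X -> boolean_combination G Y ->
    boolean_combination G (X `&` Y).

(* Main.v *)
(* A subset X of the n-th power of the product is "colorable" if there are a
   finite set J of colors, a coloring tau_l of each (A_l)^n by J, and a bound K,
   such that membership of x in X depends only on the sizes, truncated at K, of
   the color classes {l | tau_l(x[l]) = j}.  The colorings are arbitrary, so no
   Feferman-Vaught syntax is needed.  Atomic formulas say that a color class is
   empty; connectives are handled by common refinement.  For an existential
   quantifier, recolor x[l] by the set of colors its one-point extensions can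
   take: if x and y have color classes of the same size truncated at
   |J| (K + 1) + 1, a coloring achieved over x can be imitated over y.  Finally,
   "at least k indices have color j" is an open condition on x. *)
Require Import Defs.
From mathcomp Require Import all_boot all_classical.
From mathcomp Require Import topology finmap.
From mathcomp Require Import zify.

Set Implicit Arguments.
Unset Strict Implicit.
Unset Printing Implicit Defensive.

Local Open Scope classical_set_scope.

(** * Cardinalities truncated at a finite bound *)

Section TruncatedSize.
Context {I : choiceType}.
Implicit Types (k K M : nat) (S D : set I) (F G : {fset I}).

Definition atleast k S :=
  exists2 F : {fset I}, [set` F] `<=` S & (k <= #|` F|)%N.

(** Equality of cardinalities after truncation at [K]. The second disjunct does not mention [K], so
    it survives every change of bound. *)
Definition same_size K S S' :=
  (atleast K S /\ atleast K S') \/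
  exists F F', [/\ S = [set` F], S' = [set` F'] & #|` F| = #|` F'|].

Lemma atleastW k K S D : (k <= K)%N -> S `<=` D -> atleast K S -> atleast k D.
Proof.
move=> kK SD [F FS KF]; exists F; first exact: subset_trans SD.
exact: leq_trans KF.
Qed.

Lemma atleast_fset k F : atleast k [set` F] <-> (k <= #|` F|)%N.
Proof.
split=> [[G GF kG]|kF]; last by exists F.
by apply: (leq_trans kG); apply: fsubset_leq_card; apply/fsubsetP => x /GF.
Qed.

Lemma atleastVfinite K S :
  atleast K S \/ exists2 F, S = [set` F] & (#|` F| < K)%N.
Proof.
case: (pselect (finite_set S)) => [/finite_fsetP[F ->]|/(infinite_set_fset K)];
  last by left.
by case: (leqP K #|` F|) => ?; [left; exists F|right; exists F].
Qed.

Lemma atleast_setD k K S F :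
  atleast K S -> (#|` F| + k <= K)%N -> atleast k (S `\` [set` F]).
Proof.
move=> [G GS KG] Fk; exists (G `\` F)%fset.
  by rewrite set_fsetD => x [/GS].
have : (#|` (G `&` F)%fset| <= #|` F|)%N by exact/fsubset_leq_card/fsubsetIr.
rewrite cardfsD; lia.
Qed.

Lemma fsubset_of_size k F :
  (k <= #|` F|)%N -> exists2 G, (G `<=` F)%fset & #|` G| = k.
Proof.
move=> kF; exists [fset x in take k F]%fset.
  by apply/fsubsetP => x; rewrite inE => /mem_take.
rewrite card_fseq undup_id ?take_uniq ?fset_uniq // size_take.
by case: ltngtP kF.
Qed.

Lemma same_size_sym K S S' : same_size K S S' -> same_size K S' S.
Proof. by case=> [[]|[F [F' [? ? ?]]]]; [left|right; exists F', F]. Qed.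

Lemma same_sizeW k K S S' : (k <= K)%N -> same_size K S S' -> same_size k S S'.
Proof.
move=> kK [[KS KS']|]; last by right.
by left; split; [apply: atleastW KS|apply: atleastW KS'].
Qed.

Lemma same_size_fin K F F' :
  #|` F| = #|` F'| -> same_size K [set` F] [set` F'].
Proof. by right; exists F, F'. Qed.

(** For two finite sets smaller than [K], testing at both cardinalities gives the two
    inequalities. *)
Lemma same_sizeP K S S' :
  (forall k : 'I_K.+1, atleast k S <-> atleast k S') -> same_size K S S'.
Proof.
move=> SS'; case: (atleastVfinite K S) => [KS|[F eS FK]].
  by left; split=> //; exact: (iffLR (SS' ord_max)).
case: (atleastVfinite K S') => [KS'|[F' eS' FK']].
  by left; split=> //; exact: (iffRL (SS' ord_max)).
rewrite eS eS'; apply: same_size_fin; apply/eqP; rewrite eqn_leq.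
have F1 : (#|` F| < K.+1)%N by exact: ltnW.
have F1' : (#|` F'| < K.+1)%N by exact: ltnW.
have := SS' (Ordinal F1); have := SS' (Ordinal F1').
rewrite eS eS' !atleast_fset /= !leqnn => -[_ /(_ isT) ->] [+ _].
by move=> /(_ isT) ->.
Qed.

Lemma same_size_nonempty K S S' x' :
  same_size K.+1 S S' -> S' x' -> exists x, S x.
Proof.
case=> [[[F FS KF] _] _|[F [F' [-> -> eF]]] F'x].
  have /fset0Pn[x xF] : F != fset0%fset by rewrite -cardfs_gt0; lia.
  by exists x; apply: FS.
have /fset0Pn[x xF] : F != fset0%fset; last by exists x.
by rewrite -cardfs_gt0 eF cardfs_gt0; apply/fset0Pn; exists x'.
Qed.

Lemma same_size_setU K S S' D D' : S `&` D = set0 -> S' `&` D' = set0 ->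
  same_size K S S' -> same_size K D D' -> same_size K (S `|` D) (S' `|` D').
Proof.
move=> SD SD' [[KS KS'] _|[F [F' [eS eS' eF]]]].
  by left; split; [apply: atleastW KS|apply: atleastW KS'] => // x; left.
move=> [[KD KD']|[G [G' [eD eD' eG]]]].
  by left; split; [apply: atleastW KD|apply: atleastW KD'] => // x; right.
rewrite eS eS' eD eD' -!set_fsetU; apply: same_size_fin.
have disj F1 F2 : [set` F1] `&` [set` F2] = set0 :> set I ->
  (F1 `&` F2 = fset0)%fset.
  by rewrite -set_fsetI => /eqP; rewrite set_fset_eq0 => /eqP.
by rewrite !cardfsU !disj ?eF ?eG -?eS -?eS' -?eD -?eD'.
Qed.

(* The slack [K + M] lets a finite part be copied exactly while leaving enough
   points for the other part to count as large. *)
Lemma same_size_split K M S S' D :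
    same_size (K + M) S S' -> D `<=` S ->
  exists D', [/\ D' `<=` S', same_size K D D' &
                 same_size M (S `\` D) (S' `\` D')].
Proof.
move=> [[bS bS']|[F [F' [-> -> eF]]]] DS; last first.
  have /finite_fsetP[G eG] : finite_set D by exact: sub_finite_set DS _.
  have GF : (G `<=` F)%fset by apply/fsubsetP => x; rewrite eG in DS => /DS.
  have [|G' GF' eG'] := @fsubset_of_size #|` G| F'.
    by rewrite -eF; exact: fsubset_leq_card.
  exists [set` G']; split; first by move=> x; exact: (fsubsetP GF').
    by rewrite eG; exact: same_size_fin.
  rewrite eG -!set_fsetD; apply: same_size_fin.
  by rewrite !cardfsDS // eF eG'.
have pick k : (k <= K + M)%N ->
    exists2 G', [set` G'] `<=` S' & #|` G'| = k.
  move=> kKM; have [F FS KF] := bS'.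
  have [|G' GF' eG'] := @fsubset_of_size k F; first exact: leq_trans KF.
  by exists G' => // x /(fsubsetP GF')/FS.
case: (atleastVfinite K D) => [KD|[G -> GK]]; last first.
  have [|G' GS' eG'] := pick #|` G|; first by lia.
  exists [set` G']; split=> //; first exact: same_size_fin.
  by left; split; [apply: atleast_setD bS _|apply: atleast_setD bS' _]; lia.
case: (atleastVfinite M (S `\` D)) => [MD|[G eG GM]].
  have [|G' GS' eG'] := pick K; first by lia.
  exists [set` G']; split=> //.
    by left; split=> //; apply/atleast_fset; rewrite eG'.
  by left; split=> //; apply: atleast_setD bS' _; lia.
(* Here [D] is large and its complement [G] in [S] is small: the complement is copied exactly and
   [D'] is what remains. *)
have [|G' GS' eG'] := pick #|` G|; first by lia.
exists (S' `\` [set` G']); split; first by move=> x [].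
  by left; split=> //; apply: atleast_setD bS' _; lia.
by rewrite setDD (setIidr GS') eG; exact: same_size_fin.
Qed.

Lemma same_size_fibers (J : eqType) K S S' (c c' : I -> J) (js : seq J) :
    (forall j, j \in js ->
      same_size K (S `&` c @^-1` [set j]) (S' `&` c' @^-1` [set j])) ->
  same_size K (S `&` [set l | c l \in js]) (S' `&` [set l | c' l \in js]).
Proof.
elim: js => [|j js IH] cc'.
  have E (f : I -> J) T : T `&` [set l | f l \in [::]] = [set` fset0%fset].
    by apply/seteqP; split=> x // [].
  by rewrite !E; exact: same_size_fin.
have {}IH := IH (fun i ijs => cc' i (mem_behead (s := j :: js) ijs)).
have [jjs|jjs] := boolP (j \in js).
  have E (f : I -> J) : [set l | f l \in j :: js] = [set l | f l \in js].
    apply/seteqP; split=> x /=; rewrite inE; last by move=> ->; rewrite orbT.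
    by case/orP=> // /eqP ->.
  by rewrite !E.
have E (f : I -> J) T : T `&` [set l | f l \in j :: js] =
    (T `&` f @^-1` [set j]) `|` (T `&` [set l | f l \in js]).
  rewrite -setIUr; congr (_ `&` _); apply/seteqP.
  by split=> x /=; rewrite inE => /predU1P.
have D0 (f : I -> J) T :
    (T `&` f @^-1` [set j]) `&` (T `&` [set l | f l \in js]) = set0.
  by apply/seteqP; split=> x // -[[_ /= ->] [_ /=]]; rewrite (negbTE jjs).
by rewrite !E; apply: same_size_setU => //; apply: cc'; rewrite mem_head.
Qed.

(** Colors are split off one at a time, each costing [K] of the bound. *)
Lemma same_size_recolor (J : eqType) K S S' (s : I -> J) (js : seq J) :
    uniq js -> (forall l, S l -> s l \in js) ->
    same_size (size js * K).+1 S S' ->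
  exists s' : I -> option J,
    (forall l, S' l -> exists2 j, j \in js & s' l = Some j) /\
    forall j, j \in js ->
      same_size K (S `&` s @^-1` [set j]) (S' `&` s' @^-1` [set Some j]).
Proof.
elim: js S S' => [|j js IH] S S' /=.
  (* With no color left [S] is empty, and the remaining bound 1 makes [S'] empty too; [None] is a
     placeholder. *)
  move=> _ S0 SS'; exists (fun=> None); split=> // l S'l.
  by have [x /S0] := same_size_nonempty SS' S'l.
move=> /andP[jjs ujs] Sjs; rewrite mulSn -addnS => /same_size_split.
move=> /(_ (S `&` s @^-1` [set j]))[x []//|D' [D'S' eD eDc]].
have [l [Sl nl]|s' [s'js es']] := IH _ _ ujs _ eDc.
  have /predU1P[slj|//] := Sjs l Sl.
  by case: nl.
exists (fun l => if `[< D' l >] then Some j else s' l); split=> [l S'l|i].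
  case: asboolP => D'l; first by exists j; rewrite ?mem_head.
  by have [//|i ijs ->] := s'js l; exists i => //; rewrite inE ijs orbT.
rewrite inE => /predU1P[->|ijs].
  rewrite [X in same_size _ _ X](_ : _ = D') //.
  apply/seteqP; split=> l /=; last first.
    by move=> D'l; case: asboolP => //; split=> //; exact: D'S'.
  move=> [S'l]; case: asboolP => // nD' s'j.
  by have [//|k kjs] := s'js l; rewrite s'j => -[jk]; rewrite jk kjs in jjs.
have := es' i ijs.
have ij : i <> j by move=> ij; rewrite -ij ijs in jjs.
congr same_size; apply/seteqP; split=> l /=.
- by move=> [[]].
- by move=> [Sl sl]; do 2?split=> //; rewrite sl => -[].
- by move=> [[S'l nD'] s'l]; split=> //; case: asboolP.
- by move=> [S'l]; case: asboolP => // _ [] /esym.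
Qed.

(** [T l] is the set of admissible colors at [l]. The choice [s] is imitated separately on each
    class of indices sharing one admissible set; the sizes are then added over these finitely many
    classes. *)
Lemma same_size_select (J : finType) K (T T' : I -> {ffun J -> bool})
    (s : I -> J) :
    (forall l, T l (s l)) ->
    (forall t, same_size (#|J| * K.+1).+1
      (T @^-1` [set t]) (T' @^-1` [set t])) ->
  exists s' : I -> J, (forall l, T' l (s' l)) /\
    forall j, same_size K.+1 (s @^-1` [set j]) (s' @^-1` [set j]).
Proof.
move=> Ts TT'.
have /choice[r rP] t : exists r : I -> option J,
    (forall l, T' l = t -> exists2 j, j \in enum J & r l = Some j) /\
    forall j, j \in enum J -> same_size K.+1
      (T @^-1` [set t] `&` s @^-1` [set j])
      (T' @^-1` [set t] `&` r @^-1` [set Some j]).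
  apply: same_size_recolor; rewrite ?enum_uniq -?cardE //.
  by move=> l _; rewrite mem_enum.
have /choice[s' s'P] l : exists j, r (T' l) l = Some j.
  by have [/(_ l erefl)[j _ rj] _] := rP (T' l); exists j.
have cls t j : T' @^-1` [set t] `&` r t @^-1` [set Some j] =
               s' @^-1` [set j] `&` T' @^-1` [set t].
  apply/seteqP; split=> l [/= A B]; first by have := s'P l; rewrite A B => -[].
  by rewrite B -A -s'P B.
exists s'; split=> [l|j].
  (* The color [s' l] is also used by [s] at some index with the same admissible set, hence is
     admissible. Detecting this needs a positive truncation, whence [K.+1]. *)
  have [_ /(_ (s' l))] := rP (T' l); rewrite mem_enum cls.
  by move=> /(_ isT)/same_size_nonempty /(_ (conj erefl erefl))[x [/= <- <-]].
have := @same_size_fibers _ K.+1 (s @^-1` [set j]) (s' @^-1` [set j]) T T'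
  (enum {ffun J -> bool}).
have E (f : I -> {ffun J -> bool}) S :
    S `&` [set l | f l \in enum {ffun J -> bool}] = S.
  by apply/setIidl => l _ /=; rewrite mem_enum.
rewrite !E; apply=> t _; have [_ /(_ j)] := rP t.
by rewrite mem_enum cls setIC; exact.
Qed.

End TruncatedSize.

(** Induction on the tests: inside [U j] and inside its complement, [X] coincides with a set
    determined by the remaining tests. With no test left, [X] is everything or empty. *)
Lemma bool_comb_determined (T : Type) (G : set (set T)) (I : eqType)
    (U : I -> set T) (js : seq I) (X : set T) :
    G setT -> (forall j, G (U j)) ->
    (forall x y, (forall j, j \in js -> U j x <-> U j y) -> X x -> X y) ->
  boolean_combination G X.
Proof.
move=> GT GU; elim: js X => [|j js IH] X Xinv.
  case: (pselect (exists x, X x)) => [[x Xx]|X0].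
    rewrite (_ : X = setT); first exact: bc_base.
    by apply/seteqP; split=> // y _; exact: Xinv Xx.
  rewrite (_ : X = ~` setT); first exact/bc_compl/bc_base.
  by rewrite setCT; apply/seteqP; split=> // x Xx; case: X0; exists x.
(* This saturates the part of [X] in [B] under agreement on [js]. When [B] is [U j] or its
   complement, [Y B] meets [B] only in points of [X]. *)
pose Y B := [set x | exists y,
  [/\ X y, B y & forall i, i \in js -> U i x <-> U i y]].
have Ybc B : boolean_combination G (Y B).
  apply: IH => x y xy [z [Xz Bz xz]]; exists z; split=> // i ijs.
  by rewrite -xz// xy.
rewrite (_ : X = (U j `&` Y (U j)) `|` (~` U j `&` Y (~` U j))).
  by apply: bc_union; apply: bc_inter; rewrite ?Ybc //; do ?apply: bc_compl;
    exact: bc_base.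
apply/seteqP; split=> [x Xx|x].
  by case: (pselect (U j x)) => Ux; [left|right]; split=> //; exists x.
by case=> -[Ux [y [Xy Uy xy]]]; apply: (Xinv y) Xy => i;
  rewrite inE => /predU1P[->|/xy[]] //; split.
Qed.

(** * Colorable sets and their closure under logical operations *)

Section Colorings.
Context {L : language} {Lambda : Type} (A : Lambda -> structure L).

Definition slice n (x : 'I_n -> direct_product A) (l : Lambda) : 'I_n -> A l :=
  fun i => x i l.

Definition coloring n (J : Type) := forall l, ('I_n -> A l) -> J.

(** [{classic Lambda}] supplies the choice structure that finite sets of indices require. *)
Definition color_of n J (tau : coloring n J) (x : 'I_n -> direct_product A) :
  {classic Lambda} -> J := fun l => tau l (slice x l).

Definition similar n J (tau : coloring n J) K
    (x y : 'I_n -> direct_product A) :=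
  forall j, same_size K (color_of tau x @^-1` [set j])
                        (color_of tau y @^-1` [set j]).

Definition color_determined n (J : Type) (tau : coloring n J) K
    (X : set ('I_n -> direct_product A)) :=
  forall x y, similar tau K x y -> X x -> X y.

Definition colorable n (X : set ('I_n -> direct_product A)) :=
  exists (J : finType) (tau : coloring n J) K, color_determined tau K X.

Lemma similar_sym n J (tau : coloring n J) K x y :
  similar tau K x y -> similar tau K y x.
Proof. by move=> xy j; exact/same_size_sym. Qed.

(** Each coarse class is a disjoint union of finitely many fine ones. *)
Lemma similar_coarsen n (J J' : finType) (f : J -> J') (tau : coloring n J)
    k K x y :
  (k <= K)%N -> similar tau K x y -> similar (fun l z => f (tau l z)) k x y.
Proof.
move=> kK xy j; apply: (same_sizeW kK).
have E z : color_of (fun l z => f (tau l z)) z @^-1` [set j] =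
    setT `&` [set l | color_of tau z l \in [seq i <- enum J | f i == j]].
  rewrite setTI; apply/seteqP; split=> l /=; rewrite mem_filter mem_enum andbT.
    by move=> <-.
  by move/eqP.
by rewrite !E; apply: same_size_fibers => i _; rewrite !setTI.
Qed.

(** Points similar for the product coloring agree on both sets, so [op] can be any connective,
    including a unary one that ignores an argument. *)
Lemma colorable_op2 (op : Prop -> Prop -> Prop) n
    (X Y : set ('I_n -> direct_product A)) :
  colorable X -> colorable Y -> colorable [set x | op (X x) (Y x)].
Proof.
move=> [J [tau [K XP]]] [J' [tau' [K' YP]]].
exists (J * J')%type, (fun l z => (tau l z, tau' l z)), (maxn K K').
move=> x y xy /=.
have xyX := similar_coarsen fst (leq_maxl K K') xy.
have xyY := similar_coarsen snd (leq_maxr K K') xy.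
have -> : X x = X y.
  by apply/propext; split; apply: XP => //; exact: similar_sym.
by have -> : Y x = Y y
  by apply/propext; split; apply: YP => //; exact: similar_sym.
Qed.

Lemma colorable_forall_slice n (P : forall l, ('I_n -> A l) -> Prop) :
  colorable [set x | forall l, P l (slice x l)].
Proof.
(* Truncation at 1 suffices: the condition says that the class of [false] is empty. *)
exists bool, (fun l z => `[< P l z >]), 1%N => x y xy Px l.
apply: contrapT => nPl.
have [|l' /asboolPn] :=
  same_size_nonempty (x' := l : {classic Lambda}) (xy false); last by apply.
by apply/asboolPn.
Qed.

Lemma slice_extend n (x : 'I_n -> direct_product A) (a : direct_product A) l :
  slice (extend x a) l = extend (slice x l) (a l).
Proof. by apply/funext => i; rewrite /slice /extend; case: unlift. Qed.

Lemma slice_concat n m (x : 'I_n -> direct_product A)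
    (b : 'I_m -> direct_product A) l :
  slice (concat x b) l = concat (slice x l) (slice b l).
Proof. by apply/funext => i; rewrite /slice /concat; case: fintype.split. Qed.

(* The new color of a point is the set of colors its one-point extensions can
   achieve; a witness amounts to selecting one achievable color per index. *)
Lemma colorable_ex n (X : set ('I_n.+1 -> direct_product A)) :
  colorable X -> colorable [set x | exists a, X (extend x a)].
Proof.
move=> [J [tau [K XP]]].
pose sigma : coloring n {ffun J -> bool} := fun l z =>
  [ffun j => `[< exists a : A l, tau l (extend z a) = j >]].
exists {ffun J -> bool}, sigma, (#|J| * K.+1).+1 => x y xy [a Xa].
have [|s [sy es]] := same_size_select (s := color_of tau (extend x a)) _ xy.
  move=> l; rewrite /color_of ffunE; apply/asboolP; exists (a l).
  by rewrite slice_extend.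
have ex l : exists a : A l, tau l (extend (slice y l) a) = s l.
  by have := sy l; rewrite /color_of ffunE => /asboolP.
exists (fun l => sval (cid (ex l))); apply: XP Xa => j.
apply: (same_sizeW (leqnSn K)).
rewrite (_ : color_of tau (extend y _) = s); first exact: es.
by apply/funext => l; rewrite /color_of slice_extend; case: cid.
Qed.

Lemma eval_slice n (x : 'I_n -> direct_product A) (t : term L n) l :
  Defs.eval x t l = Defs.eval (slice x l) t.
Proof.
by elim: t => [//|f ts IH] /=; congr func_interp; apply/funext => i.
Qed.

Lemma colorable_sat n (phi : formula L n) :
  colorable [set x : 'I_n -> direct_product A | sat phi x].
Proof.
elim: phi => {n} [n s t|n r ts|n|n p IH|n p IHp q IHq|n p IHp q IHq
                 |n p IHp q IHq|n p IH|n p IH] /=.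
- rewrite (_ : [set _ | _] = [set x : 'I_n -> direct_product A |
      forall l, Defs.eval (slice x l) s = Defs.eval (slice x l) t]).
    exact: (colorable_forall_slice (fun l z => Defs.eval z s = Defs.eval z t)).
  apply/seteqP; split=> x /=.
    by move=> e l; rewrite -!eval_slice e.
  by move=> e; apply: functional_extensionality_dep => l; rewrite !eval_slice.
- rewrite (_ : [set _ | _] = [set x : 'I_n -> direct_product A |
      forall l, rel_interp (A l) r (fun i => Defs.eval (slice x l) (ts i))]).
    exact: (colorable_forall_slice
      (fun l z => rel_interp (A l) r (fun i => Defs.eval z (ts i)))).
  apply/seteqP; split=> x /= h l; have := h l;
    by congr rel_interp; apply/funext => i; rewrite eval_slice.
- by exists unit, (fun _ _ => tt), 0%N.
- exact: (colorable_op2 (fun P _ => ~ P) IH IH).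
- exact: (colorable_op2 and IHp IHq).
- exact: (colorable_op2 or IHp IHq).
- exact: (colorable_op2 (fun P Q => P -> Q) IHp IHq).
(* A universal quantifier is treated as the negation of an existential one. *)
- have nIH := colorable_op2 (fun P _ => ~ P) IH IH.
  have nex := colorable_ex nIH.
  have := colorable_op2 (fun P _ => ~ P) nex nex.
  congr colorable; apply/seteqP; split=> x /=.
    by move=> h a; apply: contrapT => na; apply: h; exists a.
  by move=> h [a]; apply; exact: h.
- exact: colorable_ex.
Qed.

(** Colorings may vary with the index, so they absorb the slices of the parameters. *)
Lemma colorable_parameters n m (X : set ('I_(n + m) -> direct_product A)) b :
  colorable X -> colorable [set x : 'I_n -> direct_product A | X (concat x b)].
Proof.
move=> [J [tau [K XP]]].
exists J, (fun l z => tau l (concat z (slice b l))), K => x y xy.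
apply: XP => j; have := xy j; congr same_size; apply/seteqP;
  by split=> l /=; rewrite /color_of slice_concat.
Qed.

Lemma colorable_definable n (X : set ('I_n -> direct_product A)) :
  definable X -> colorable X.
Proof.
by move=> [m [phi [b ->]]]; exact: colorable_parameters (colorable_sat phi).
Qed.

(** * Openness of the counting conditions *)

Local Notation power n := (discrete_product_power A n).

(** A slice consists of [n] coordinates, each a continuous map to a discrete space, so fixing all of
    them gives a neighborhood. *)
Lemma open_slice n l (P : set ('I_n -> A l)) :
  open [set x : power n | P (slice (x : 'I_n -> direct_product A) l)].
Proof.
have coord i (a : A l) : open [set x : power n | x i l = a].
  pose fiber := prod_topology (fun k : {classic Lambda} =>
    discrete_topology {classic A k}).
  have coord_i : continuous (fun x : power n => x i).
    exact: (@proj_continuous _ (fun _ : 'I_n => prod_topology (fun k : Lambda =>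
      discrete_topology {classic A k})) i).
  have coord_l : continuous (fun y : fiber => y l).
    exact: (@proj_continuous {classic Lambda}
      (fun k => discrete_topology {classic A k}) l).
  apply: (@open_comp _ _ (fun x : power n => x i) [set y | y l = a]) => [x _|].
    exact: coord_i.
  apply: (@open_comp fiber (discrete_topology {classic A l})
    (fun y => y l) [set a]) => [y _|]; first exact: coord_l.
  exact: discrete_open.
rewrite openE => x Px.
apply: (@filterS _ _ _ [set y : power n | forall i, y i l = x i l]).
  move=> y yx /=.
  rewrite (_ : slice _ l = slice (x : 'I_n -> direct_product A) l) //.
  exact/funext.
apply: (@filter_forall _ _ (fun i => [set y : power n | y i l = x i l])
  (nbhs (x : power n)) _) => i.
apply: (@open_nbhs_nbhs _ (x : power n)); split=> //; exact: coord.
Qed.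

(** A finite set of indices witnessing the count still does so at nearby points, since each of its
    colors is locally constant. *)
Lemma open_atleast n (J : Type) (tau : coloring n J) k j :
  open [set x : power n | atleast k (color_of tau x @^-1` [set j])].
Proof.
rewrite openE => x [F Fx kF].
apply: (@filterS _ _ _ (\bigcap_(l in [set` F])
    [set y : power n | color_of tau y l = j])).
  by move=> y yF; exists F.
apply: filter_bigI => l /Fx xl; apply: open_nbhs_nbhs; split=> //.
exact: (open_slice [set z | tau l z = j]).
Qed.

(** Counting up to [K] in each color is a finite list of open tests that decides similarity. *)
Lemma colorable_boolean_combination n (X : set ('I_n -> direct_product A)) :
  colorable X -> boolean_combination [set U : set (power n) | open U] X.
Proof.
move=> [J [tau [K XP]]].
apply: (bool_comb_determined
  (U := fun jk : J * 'I_K.+1 =>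
          [set x : power n | atleast jk.2 (color_of tau x @^-1` [set jk.1])])
  (js := enum {: J * 'I_K.+1})).
- exact: openT.
- by move=> jk; exact: open_atleast.
- move=> x y xy; apply: XP => j; apply: same_sizeP => k.
  by apply: (xy (j, k)); rewrite mem_enum.
Qed.

End Colorings.

Theorem theorem2p14 (L : language) (Lambda : Type)
    (A : Lambda -> structure L) (n : nat)
    (X : set ('I_n -> direct_product A)) :
  definable X ->
  boolean_combination
    [set U : set (discrete_product_power A n) | open U]%classic X.
Proof.
by move=> /colorable_definable; exact: colorable_boolean_combination.
Qed.
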